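(* Let $d,n$ be positive integers and $0\le k\le n$ an integer. Then $$\det\left(\binom{n+d+j-i-1}{n-1}_{F(s,t)}\right)_{i,j=0}^{k-1}=(-t)^{\binom{k}{2}d}\left\langle \begin{matrix} n\\ k\end{matrix}\right\rangle_{d,F(s,t)}.$$
   Context: $s,t$ are indeterminates. Fibonacci polynomials: $F_0(s,t)=0$, $F_1(s,t)=1$, $F_n(s,t)=sF_{n-1}(s,t)+tF_{n-2}(s,t)$. Fibonomials: $\binom{m}{k}_{F(s,t)}=\prod_{j=0}^{k-1}\frac{F_{m-j}(s,t)}{F_{k-j}(s,t)}$ for $0\le k\le m$, and $0$ if $k<0$ or $k>m$. Hoggatt coefficients: for $0\le k\le n$, $\left\langle \begin{matrix} n\\ k\end{matrix}\right\rangle_{d,F(s,t)}=\prod_{j=0}^{k-1}\frac{\binom{n-j+d-1}{d}_{F(s,t)}}{\binom{k-j+d-1}{d}_{F(s,t)}}$. A $0\times0$ determinant equals $1$. *)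

(* Defs.v *)
From HB Require Import structures.
From mathcomp Require Import all_boot all_order all_algebra.
From mathcomp Require Import mpoly.

Set Implicit Arguments.
Unset Strict Implicit.
Unset Printing Implicit Defensive.

Import GRing.Theory.
Local Open Scope ring_scope.

Notation "x %:F" := (@tofrac _ x) : ring_scope.

(* The ring Z[s,t] of the indeterminates, and its field of fractions. *)
Notation Zst := {mpoly int[2]}.
Notation Qst := {fraction {mpoly int[2]}}.

Definition s : Zst := 'X_(@Ordinal 2 0 isT).
Definition t : Zst := 'X_(@Ordinal 2 1 isT).

Fixpoint fibpoly (n : nat) : Zst :=
  match n with
  | 0 => 0
  | n'.+1 => match n' with
             | 0 => 1
             | n''.+1 => s * fibpoly n' + t * fibpoly n''
             end
  end.

(* Since k : nat, the convention "0 when k < 0" is vacuous. *)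
Definition fibonomial (m k : nat) : Qst :=
  if (k <= m)%N then
    \prod_(j < k) ((fibpoly (m - j))%:F / (fibpoly (k - j))%:F)
  else 0.

(* Meaningful for k <= n: then no natural subtraction truncates. *)
Definition hoggatt (d n k : nat) : Qst :=
  \prod_(j < k)
    (fibonomial (n - j + d - 1) d / fibonomial (k - j + d - 1) d).

(* Main.v *)
Require Import Defs.
From HB Require Import structures.
From mathcomp Require Import all_boot all_order all_algebra.
From mathcomp Require Import mpoly zify ring.

Import GRing.Theory.
Local Open Scope ring_scope.

(* The matrix is Toeplitz, so Desnanot-Jacobi condensation relates the
   determinants of sizes k, k+1, k+2 for the parameters d-1, d, d+1.  The right-hand
   side is nonzero and satisfies the same recurrence, which after cancelling the
   common factors is the Vajda identity
   F(a+d) F(b+d) - F(a+b+d) F(d) = (-t)^d F(a) F(b)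
   with a = n-k-1 and b = k+1.  For d = 0 the matrix is unitriangular. *)

(** * Determinants: Desnanot-Jacobi condensation *)

Lemma lift_max_0 n : lift (@ord_max n.+1) ord0 = ord0.
Proof. exact: val_inj. Qed.

Lemma lift_0_max n : lift (@ord0 n.+1) ord_max = ord_max.
Proof. exact: val_inj. Qed.

Lemma lift_max_lift_0 n (i : 'I_n) :
  lift (@ord_max n.+1) (lift ord0 i) = lift ord0 (lift ord_max i).
Proof. by apply: val_inj; rewrite /= /bump /= !add1n ltnS addnS. Qed.

(** The cofactors along row 0 do not see row 0, and pairing them with any other row gives an
    off-diagonal entry of [A *m \adj A], which is 0. *)
Lemma det_sub_row0 (R : comPzRingType) n (A : 'M[R]_n.+1) (w : 'I_n -> R) :
  \det (\matrix_(i, j) if i == ord0 then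
      A ord0 j - \sum_l w l * A (lift ord0 l) j else A i j) = \det A.
Proof.
set B := (X in \det X = _).
have cofB j : cofactor B ord0 j = cofactor A ord0 j.
  by rewrite /cofactor; congr (_ * \det _); apply/matrixP=> p q; rewrite !mxE.
rewrite (expand_det_row B ord0) (expand_det_row A ord0).
under eq_bigr => j _ do rewrite cofB mxE eqxx mulrBl.
rewrite sumrB -[RHS]subr0; congr (_ - _).
under eq_bigr => j _ do rewrite mulr_suml.
rewrite exchange_big big1 //= => l _.
under eq_bigr => j _ do rewrite -mulrA.
have /matrixP/(_ (lift ord0 l) ord0) := mul_mx_adj A.
rewrite -mulr_sumr !mxE /= mulr0n => adjA; rewrite -[RHS](mulr0 (w l)).
by rewrite -[in RHS]adjA; congr (_ * _); apply: eq_bigr => j _; rewrite mxE.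
Qed.

(** Each determinant that retains row 0 expands along it into corner terms only, so the identity
    becomes formal in the two corner entries. *)
Lemma desnanot_jacobi_row0 (R : comPzRingType) k (B : 'M[R]_k.+2) :
    (forall l : 'I_k, B ord0 (lift ord0 (lift ord_max l)) = 0) ->
  \det B * \det (row' ord0 (col' ord0 (row' ord_max (col' ord_max B)))) =
  \det (row' ord0 (col' ord0 B)) * \det (row' ord_max (col' ord_max B)) -
  \det (row' ord0 (col' ord_max B)) * \det (row' ord_max (col' ord0 B)).
Proof.
move=> B0; set C := (X in _ * \det X = _).
have detmm : \det (row' ord_max (col' ord_max B)) = B ord0 ord0 * \det C.
  rewrite (expand_det_row _ ord0) (bigD1_ord ord0) //= big1 ?addr0.
    by rewrite !mxE !lift_max_0 /cofactor /= expr0 mul1r.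
  by move=> l _; rewrite !mxE lift_max_0 lift_max_lift_0 B0 mul0r.
have detm0 : \det (row' ord_max (col' ord0 B)) =
    B ord0 ord_max * ((-1) ^+ k * \det C).
  rewrite (expand_det_row _ ord0) (bigD1_ord ord_max) //= big1 ?addr0.
    rewrite !mxE lift_max_0 lift_0_max /cofactor /= add0n.
    congr (_ * (_ * \det _)); apply/matrixP=> i j.
    by rewrite !mxE !lift_max_lift_0.
  by move=> l _; rewrite !mxE lift_max_0 B0 mul0r.
have detB : \det B = B ord0 ord0 * \det (row' ord0 (col' ord0 B))
    + B ord0 ord_max * ((-1) ^+ k.+1 * \det (row' ord0 (col' ord_max B))).
  rewrite (expand_det_row _ ord0) (bigD1_ord ord0) //=.
  rewrite (bigD1_ord ord_max) //= big1 ?addr0.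
    by rewrite lift_0_max /cofactor /= add0n expr0 mul1r.
  by move=> l _; rewrite B0 mul0r.
rewrite detmm detm0 detB exprS; ring.
Qed.

(* Row 0 of [A] modulo the interior rows can be made to vanish on the interior
   columns, and this changes none of the minors involved. *)
Lemma desnanot_jacobi (R : comUnitRingType) k (A : 'M[R]_k.+2) :
    row' ord0 (col' ord0 (row' ord_max (col' ord_max A))) \in unitmx ->
  \det A * \det (row' ord0 (col' ord0 (row' ord_max (col' ord_max A)))) =
  \det (row' ord0 (col' ord0 A)) * \det (row' ord_max (col' ord_max A)) -
  \det (row' ord0 (col' ord_max A)) * \det (row' ord_max (col' ord0 A)).
Proof.
set C := (X in X \in unitmx) => Cu.
(* The coefficients solve [w *m C] = interior part of row 0; this is where invertibility of [C]
   enters. *)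
pose w := (\row_l A ord0 (lift ord0 (lift ord_max l))) *m invmx C.
pose B := \matrix_(i, j) if i == ord0 then
  A ord0 j - \sum_l w 0 l * A (lift ord0 (lift ord_max l)) j else A i j.
have B0 (l : 'I_k) : B ord0 (lift ord0 (lift ord_max l)) = 0.
  have : w *m C = \row_l A ord0 (lift ord0 (lift ord_max l)) by rewrite mulmxKV.
  move=> /matrixP/(_ 0 l); rewrite !mxE eqxx => <-.
  apply/eqP; rewrite subr_eq0; apply/eqP/eq_bigr => i _.
  by rewrite !mxE !lift_max_lift_0.
have minor0 c : row' ord0 (col' c B) = row' ord0 (col' c A).
  by apply/matrixP=> i j; rewrite !mxE.
have minorm c :
    \det (row' ord_max (col' c B)) = \det (row' ord_max (col' c A)).
  rewrite -(det_sub_row0 _ _ (row' ord_max (col' c A)) (w 0)).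
  congr (\det _); apply/matrixP=> i j; rewrite !mxE.
  rewrite -(inj_eq (@lift_inj _ (@ord_max k.+1))) !lift_max_0; case: ifP => // _.
  by congr (_ - _); apply: eq_bigr => l _; rewrite !mxE !lift_max_lift_0.
rewrite -/C; have -> : C = row' ord0 (col' ord0 (row' ord_max (col' ord_max B))).
  by apply/matrixP=> i j; rewrite !mxE !lift_max_lift_0.
rewrite -!minor0 -!minorm -desnanot_jacobi_row0 //; congr (_ * _).
(* For the full matrix, [w] is extended by the coefficient 0 on the last row. *)
rewrite -(det_sub_row0 _ _ A (fun l => oapp (w 0) 0 (unlift ord_max l))).
congr (\det _); apply/matrixP=> i j; rewrite !mxE.
case: ifP => // _; congr (_ - _); rewrite (bigD1_ord ord_max) //=.
rewrite unlift_none mul0r add0r.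
by apply: eq_bigr => l _; rewrite liftK.
Qed.

(** * Fibonacci sequences over a field: Vajda's identity and the Hoggatt recurrences *)

Section FibonacciSequence.

Variables (K : fieldType) (s t : K) (F : nat -> K).
Hypotheses (F0 : F 0 = 0) (F1 : F 1 = 1).
Hypothesis FSS : forall n, F n.+2 = s * F n.+1 + t * F n.

(** Both sides obey the Fibonacci recurrence in [b], so the cases [b = 0] and [b = 1] suffice. *)
Lemma vajda_step a b d :
  F (a + d).+1 * F (b + d).+1 - F (a + b + d).+1 * F d.+1 =
  - t * (F (a + d) * F (b + d) - F (a + b + d) * F d).
Proof.
elim/ltn_ind: b => -[|[|b]] IH.
- by rewrite addn0 add0n; ring.
- by rewrite addn1 !addSn add0n !FSS; ring.
have := IH b (ltnW (ltnSn _)); have := IH b.+1 (ltnSn _).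
rewrite !addnS !addSn !(FSS (_ + _).+1) => E1 E0.
transitivity (s * (- t * (F (a + d) * F (b + d).+1 - F (a + b + d).+1 * F d))
  + t * (- t * (F (a + d) * F (b + d) - F (a + b + d) * F d))).
  by rewrite -E1 -E0; ring.
by rewrite (FSS (b + d)) (FSS (a + b + d)); ring.
Qed.

Lemma vajda a b d :
  F (a + d) * F (b + d) - F (a + b + d) * F d = (- t) ^+ d * F a * F b.
Proof.
elim: d => [|d IH]; first by rewrite F0 !addn0 mulr0 subr0 expr0 mul1r.
by rewrite !addnS vajda_step IH exprS; ring.
Qed.

Hypothesis FS_neq0 : forall n, F n.+1 != 0.

Definition fibfact n : K := \prod_(i < n) F i.+1.

(** The fibonomial with upper index [m + d] and lower index [d]: this indexing avoids subtraction
    and makes the symmetry in [m] and [d] visible. *)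
Definition fibbin m d : K := fibfact (m + d) / (fibfact m * fibfact d).

Lemma fibfact_neq0 n : fibfact n != 0.
Proof. by apply/prodf_neq0 => i _; apply: FS_neq0. Qed.

Lemma fibfactS n : fibfact n.+1 = fibfact n * F n.+1.
Proof. exact: big_ord_recr. Qed.

Lemma fibbin_neq0 m d : fibbin m d != 0.
Proof. by rewrite mulf_neq0 ?invr_eq0 ?mulf_neq0 ?fibfact_neq0. Qed.

Lemma fibbinS m d : fibbin m d.+1 = fibbin m d * (F (m + d).+1 / F d.+1).
Proof.
rewrite /fibbin addnS !fibfactS; field.
by rewrite !fibfact_neq0 FS_neq0.
Qed.

(** The Hoggatt coefficient with its denominators in reverse order: the factors no longer depend on
    [k], so raising [k] appends a single factor. *)
Definition fibhoggatt n d k : K :=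
  \prod_(j < k) (fibbin (n - 1 - j) d / fibbin j d).

Lemma fibhoggattS n d k : fibhoggatt n d k.+1 =
  fibhoggatt n d k * (fibbin (n - 1 - k) d / fibbin k d).
Proof. exact: big_ord_recr. Qed.

Lemma fibhoggatt_neq0 n d k : fibhoggatt n d k != 0.
Proof.
by apply/prodf_neq0 => i _; rewrite mulf_neq0 ?invr_eq0 ?fibbin_neq0.
Qed.

(** This compares three consecutive values of [d] at fixed [k]. Raising [k] by one multiplies both
    sides by the same square. *)
Lemma fibhoggatt_logconcave n d k : (k <= n)%N ->
  fibhoggatt n d.+2 k * fibhoggatt n d k * (F (n - k + d).+1 * F (k + d).+1) =
  fibhoggatt n d.+1 k ^+ 2 * (F (n + d).+1 * F d.+1).
Proof.
elim: k => [|k IH] lkn; first by rewrite /fibhoggatt !big_ord0 subn0 add0n; ring.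
have {}IH := IH (ltnW lkn).
have [m def_n] : exists m, n = (m + k.+1)%N by exists (n - k.+1)%N; rewrite subnK.
have mE : (n - k.+1 = m)%N by rewrite def_n addnK.
have mE1 : (n - 1 - k = m)%N by rewrite -subnDA add1n.
have mE2 : (n - k = m.+1)%N by rewrite def_n -addSnnS addnK.
rewrite mE2 !addSn in IH; rewrite mE !fibhoggattS mE1 !fibbinS !addnS !addSn.
(* [q] is the factor that [fibhoggatt n d.+1 k] gains when [k] becomes [k.+1]. *)
pose q := (fibbin m d / fibbin k d) * (F (m + d).+1 / F (k + d).+1).
transitivity (fibhoggatt n d.+1 k ^+ 2 * (F (n + d).+1 * F d.+1) * q ^+ 2).
  by rewrite -IH /q; field; rewrite !FS_neq0 fibbin_neq0.
by rewrite /q; field; rewrite !FS_neq0 fibbin_neq0.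
Qed.

Lemma fibbinn0 m : fibbin m 0 = 1.
Proof.
by rewrite /fibbin addn0 [fibfact 0]big_ord0 mulr1 divff ?fibfact_neq0.
Qed.

Lemma fibbinC m d : fibbin m d = fibbin d m.
Proof. by rewrite /fibbin addnC [fibfact m * _]mulrC. Qed.

Lemma fibbinSl m d : fibbin m.+1 d = fibbin m d * (F (m + d).+1 / F m.+1).
Proof. by rewrite fibbinC fibbinS fibbinC addnC. Qed.

(** This compares three consecutive values of [k] at fixed [d]: the left product over the square is
    a quotient of two successive factors, whose fibonomials differ by one in the upper index. *)
Lemma fibhoggatt_ratio n d k : (k.+1 < n)%N ->
  fibhoggatt n d k.+2 * fibhoggatt n d k
    * (F (n - k.+1 + d) * F (k.+1 + d)) =
  fibhoggatt n d k.+1 ^+ 2 * (F (n - k.+1) * F k.+1).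
Proof.
move=> lkn; have -> : (n - k.+1 = (n - k.+2).+1)%N by lia.
rewrite !fibhoggattS (_ : n - 1 - k.+1 = n - k.+2)%N; last by lia.
rewrite (_ : n - 1 - k = (n - k.+2).+1)%N; last by lia.
rewrite !fibbinSl !addSn; field.
by rewrite !FS_neq0 !fibbin_neq0.
Qed.

Lemma prod_fib_falling m k : (k <= m)%N ->
  \prod_(j < k) F (m - j) * fibfact (m - k) = fibfact m.
Proof.
elim: k => [|k IH] lekm; first by rewrite big_ord0 mul1r subn0.
rewrite big_ord_recr /= -IH ?(ltnW lekm) // -mulrA; congr (_ * _).
by rewrite (_ : m - k = (m - k.+1).+1)%N ?fibfactS 1?mulrC //; lia.
Qed.

(** * Evaluation of the Toeplitz determinants *)

Definition fibbinomial m k : K :=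
  if (k <= m)%N then fibbin (m - k) k else 0.

Hypothesis t_neq0 : t != 0.

Definition toeplitz n d k : 'M[K]_k :=
  \matrix_(i, j) fibbinomial (n + d + j - i - 1) (n - 1).

Lemma det_toeplitz_condensation n d k : \det (toeplitz n d.+1 k) != 0 ->
  \det (toeplitz n d.+1 k.+2) * \det (toeplitz n d.+1 k) =
  \det (toeplitz n d.+1 k.+1) ^+ 2 -
  \det (toeplitz n d k.+1) * \det (toeplitz n d.+2 k.+1).
Proof.
have Emm m : row' ord_max (col' ord_max (toeplitz n d.+1 m.+1)) =
    toeplitz n d.+1 m by apply/matrixP=> i j; rewrite !mxE !lift_max.
have E00 m e : row' ord0 (col' ord0 (toeplitz n e m.+1)) = toeplitz n e m.
  by apply/matrixP=> i j; rewrite !mxE !lift0 addnS subSS.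
(* Deleting the first row and last column lowers [j - i] by one, which amounts to lowering [d]; the
   opposite corner raises it. *)
have E0m m : row' ord0 (col' ord_max (toeplitz n d.+1 m.+1)) = toeplitz n d m.
  by apply/matrixP=> i j; rewrite !mxE lift0 lift_max !addnS addSn subSS.
have Em0 m : row' ord_max (col' ord0 (toeplitz n d.+1 m.+1)) =
    toeplitz n d.+2 m.
  by apply/matrixP=> i j; rewrite !mxE lift0 lift_max !addnS !addSn.
have := @desnanot_jacobi K k (toeplitz n d.+1 k.+2).
rewrite Emm !E00 Em0 E0m unitmxE unitfE => H /H ->.
by rewrite expr2.
Qed.

Lemma det_toeplitz0 n k : (0 < n)%N -> (k <= n)%N -> \det (toeplitz n 0 k) = 1.
Proof.
move=> n_gt0 lekn; rewrite -det_tr det_trig.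
  rewrite big1 // => i _; rewrite !mxE addn0 addnK /fibbinomial leqnn subnn.
  by rewrite fibbinC fibbinn0.
(* Below the diagonal the upper index is less than [n - 1]; [k <= n] keeps the subtraction from
   truncating. *)
apply/is_trig_mxP => i j lij; rewrite !mxE /fibbinomial ifN // -ltnNge.
have := leq_trans (ltn_ord j) lekn; lia.
Qed.

Lemma det_toeplitz n d k : (0 < n)%N -> (k <= n)%N ->
  \det (toeplitz n d k) = (- t) ^+ ('C(k, 2) * d) * fibhoggatt n d k.
Proof.
move=> n_gt0; elim/ltn_ind: k d => -[|[|k]] IH d lekn.
- by rewrite det_mx00 /fibhoggatt big_ord0 mulr1.
- rewrite det_mx11 mxE mul1r /fibhoggatt big_ord1 /fibbinomial /=.
  have -> : (n + d + 0 - 0 - 1 = d + (n - 1))%N by lia.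
  by rewrite leq_addl addnK subn0 fibbinC [fibbin 0 d]fibbinC fibbinn0 divr1.
(* Condensation needs a predecessor of the parameter, so [d = 0] is treated directly. *)
case: d => [|d].
  rewrite muln0 mul1r det_toeplitz0 // /fibhoggatt big1 // => i _.
  by rewrite !fibbinn0 divr1.
have IHk e := IH k (ltnW (ltnSn _)) e (ltnW (ltnW lekn)).
have IHk1 e := IH k.+1 (ltnSn _) e (ltnW lekn).
have det_neq0 : \det (toeplitz n d.+1 k) != 0.
  by rewrite IHk mulf_neq0 ?expf_neq0 ?oppr_eq0 ?fibhoggatt_neq0.
apply: (mulIf det_neq0); rewrite det_toeplitz_condensation // IHk !IHk1.
have := fibhoggatt_logconcave n d k.+1 (ltnW lekn).
have := fibhoggatt_ratio n d.+1 k lekn.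
have := vajda (n - k.+1) k.+1 d.+1.
rewrite (_ : n - k.+1 + k.+1 + d.+1 = (n + d).+1)%N; last by lia.
rewrite addnS (addnS k.+1).
(* [P * Q] is the common left factor in [ratio] and [logc]; multiplying the goal by it lets both be
   substituted, and then [vaj] evaluates [P * Q - W]. *)
set P := F _.+1; set Q := F _.+1; set W := F _.+1 * F _.+1.
have PQ_neq0 : P * Q != 0 by rewrite mulf_neq0 ?FS_neq0.
set x := F (n - _); set y := F k.+1 => vaj ratio logc.
apply: (mulIf PQ_neq0); rewrite !(binS _ 1) !bin1 in logc *.
set u := (- t) ^+ d.+1 in vaj *.
have uE c : (- t) ^+ (c * d.+1) = u ^+ c by rewrite mulnC exprM.
have uE2 c : (- t) ^+ (c * d) * (- t) ^+ (c * d.+2) = u ^+ c ^+ 2.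
  by rewrite -exprD -exprM -exprM; congr (_ ^+ _); lia.
rewrite !uE; set c := 'C(k, 2) in uE2 *; set h := fibhoggatt n in ratio logc *.
(* This is ['C(k.+2, 2) + 'C(k, 2) = 2 * 'C(k.+1, 2) + 1]; the extra [u] is the power of [- t] in
   Vajda's identity. *)
have uE3 : u ^+ (c + k + k.+1) * u ^+ c = u * u ^+ (c + k) ^+ 2.
  by rewrite -exprM -exprD -exprS; congr (_ ^+ _); lia.
rewrite [_ * h d _ * _]mulrACA uE2.
transitivity (u ^+ (c + k) ^+ 2 *
    (h d.+1 k.+1 ^+ 2 * (P * Q) - h d.+2 k.+1 * h d k.+1 * (P * Q))).
  by ring.
rewrite logc -mulrBr vaj [RHS](_ : _ = u ^+ (c + k + k.+1) * u ^+ c *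
    (h d.+1 k.+2 * h d.+1 k * (P * Q))); last by ring.
by rewrite ratio uE3; ring.
Qed.
End FibonacciSequence.

(** * Transfer to the Fibonacci polynomials in the fraction field *)

Lemma fibpoly_neq0 n : fibpoly n.+1 != 0.
Proof.
(* At [s = 1], [t = 0] every Fibonacci polynomial of positive index takes the value 1. *)
pose v (i : 'I_2) : int := (i == ord0)%:R.
suff : (fibpoly n.+1).@[v] = 1 by apply: contra_eq_neq => ->; rewrite meval0.
elim: n => [|n IH]; first by rewrite /= meval1.
rewrite [fibpoly _]/(s * fibpoly n.+1 + t * fibpoly n).
by rewrite mevalD !mevalM IH !mevalXU mul1r mul0r addr0.
Qed.

Definition fibfrac n : Qst := (fibpoly n)%:F.

Lemma fibfrac_neq0 n : fibfrac n.+1 != 0.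
Proof. by rewrite tofrac_eq0 fibpoly_neq0. Qed.

Lemma fibonomialE m k : fibonomial m k = fibbinomial Qst fibfrac m k.
Proof.
rewrite /fibonomial /fibbinomial /fibbin; case: ifP => // lekm.
rewrite subnK // big_split /= prodfV -/fibfrac.
rewrite -(prod_fib_falling Qst fibfrac m k) //.
rewrite -[fibfact _ _ k](prod_fib_falling Qst fibfrac k k) // subnn.
rewrite [fibfact _ _ 0]big_ord0 mulr1 [fibfact _ _ _ * _]mulrC -mulf_div.
by rewrite divff ?(fibfact_neq0 _ _ fibfrac_neq0) // mulr1.
Qed.

Lemma hoggattE d n k : (0 < d)%N -> (k <= n)%N ->
  hoggatt d n k = fibhoggatt Qst fibfrac n d k.
Proof.
move=> d_gt0 lekn; rewrite [LHS]big_split [RHS]big_split /= !prodfV.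
have fibE m : fibonomial (m + d) d = fibbin Qst fibfrac m d.
  by rewrite fibonomialE /fibbinomial leq_addl addnK.
congr (_ / _).
  apply: eq_bigr => j _; rewrite -fibE.
  by congr fibonomial; have := ltn_ord j; lia.
(* Only the denominators run in opposite orders in the two products. *)
rewrite (reindex_inj rev_ord_inj) /=.
apply: eq_bigr => j _; rewrite -fibE.
by congr fibonomial; have := ltn_ord j; lia.
Qed.

Theorem theorem16 (d n k : nat) (hd : (0 < d)%N) (hn : (0 < n)%N)
  (hk : (k <= n)%N) :
  \det (\matrix_(i < k, j < k) fibonomial (n + d + j - i - 1) (n - 1)) =
  (- t%:F) ^+ ('C(k, 2) * d) * hoggatt d n k.
Proof.
rewrite hoggattE // -(det_toeplitz Qst s%:F t%:F fibfrac) //.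
- by congr (\det _); apply/matrixP=> i j; rewrite !mxE fibonomialE.
- by move=> m; rewrite -!tofracM -tofracD.
- by move=> m; rewrite tofrac_eq0 fibpoly_neq0.
- have : t.@[fun=> 1 : int] = 1 by exact: mevalXU.
  by rewrite tofrac_eq0; apply: contra_eq_neq => ->; rewrite meval0.
Qed.
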